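(* Let $\mathcal G$, $W=[w_{ij}]\in\mathbb R^{N\times N}$, $p,q$, $\lambda_1,\dots,\lambda_N$ and $f_1,\dots,f_N$ be as in the context. Assume: (1) the spectral radius of $W$ is $1$; (2) the directed graph $\mathcal G$ is strongly connected; (3) the blended dynamics $s[t+1]=f_s(t,s[t])$, where $f_s(t,s):=\sum_{i=1}^N q_i f_i(t,p_i s)$, is contractive: there exist a symmetric positive definite matrix $H\in\mathbb R^{n\times n}$ and a constant $0<\gamma<1$ such that $\frac{\partial f_s}{\partial s}(t,s)^\top H^2\frac{\partial f_s}{\partial s}(t,s)\le\gamma H^2$ for all $s\in\mathbb R^n$, $t\in\mathbb Z$; (4) there exist a non-decreasing continuous function $M:\mathbb R\to\mathbb R$ and a constant $L\ge 0$ such that $\|f_i(t,x)\|\le M(\|x\|)$ and $\|f_i(t,x)-f_i(t,y)\|\le L\|x-y\|$ for all $x,y\in\mathbb R^n$, $t\in\mathbb Z$, $i\in\mathcal N$. Then for every $\epsilon>0$ there exists $K^{\min}$ such that for every integer $K>K^{\min}$, the solution $(x_1,\dots,x_N)$ of the multi-step coupling algorithm with parameter $K$ and the solution $s$ of the blended dynamics, both started from arbitrary initial conditions, satisfy $$\limsup_{t\to\infty}\|x_i[t]-p_i s[t]\|\le\epsilon,\qquad\forall i\in\mathcal N,$$ and, in addition, for each $k\in\{1,2,\dots,K-1\}$ and $i\in\mathcal N$, $$\limsup_{t\to\infty}\|x_i[t_k]-p_i s[t+1]\|\le\frac{\epsilon}{2}\left(1+\frac{1}{|\lambda_N|^{K-k}}\right),$$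 where the right-hand side is read as $+\infty$ if $\lambda_N=0$. (Here $K^{\min}$ does not depend on the initial conditions.)
   Context: Graph and weights. $\mathcal G=(\mathcal N,\mathcal E)$ is a directed graph with node set $\mathcal N=\{1,\dots,N\}$ and no self-connections; $(j,i)\in\mathcal E$ means that node $j$ sends information to node $i$, and $\mathcal N_i=\{j:(j,i)\in\mathcal E\}$ is the set of in-neighbors of $i$. $\mathcal G$ is strongly connected if there is a directed path from any node to any other node. The weight matrix $W=[w_{ij}]$ satisfies $w_{ij}>0$ if $j\in\mathcal N_i\cup\{i\}$ and $w_{ij}=0$ otherwise. Eigenvalues and eigenvectors. $\lambda_1,\dots,\lambda_N$ are the eigenvalues of $W$ (with algebraic multiplicity) ordered so that $|\lambda_1|\ge|\lambda_2|\ge\dots\ge|\lambda_N|$. When $W$ has spectral radius $1$ and $\mathcal G$ is strongly connected, $1$ is a simple eigenvalue of $W$, strictly larger in modulus than all others, and there exist vectors $p,q\in\mathbb R^N$ with all entries positive such that $Wp=p$, $q^\top W=q^\top$, $q^\top p=1$; fix such $p=(p_i)$ and $q=(q_i)$. Node dynamics. Each $f_i:\mathbb Z\times\mathbb R^n\to\mathbb R^n$ is continuously differentiable (in its second argument). Fractional time. For $K\in\mathbb N$, an integer $t$ and $k\in\{0,\dots,K\}$, put $t_k=t+k/K$; thus $t_0=t$ and $t_K=(t+1)_0=t+1$, and time advances as $0_0,0_1,\dots,0_{K-1},1_0,1_1,\dots$. Multi-step coupling algorithm with parameter $K$. The states $x_i\in\mathbb R^n$, $i\in\mathcal N$, evolve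 from initial values $x_i[0]$ by $$x_i[t_{k+1}]=\begin{cases} f_i(t,x_i[t]), & k=0,\\ \sum_{j\in\mathcal N_i\cup\{i\}}w_{ij}\,x_j[t_k], & k=1,\dots,K-1,\end{cases}$$ for $t=0,1,2,\dots$. Blended dynamics. $s[t+1]=f_s(t,s[t])$, $s[t]\in\mathbb R^n$, indexed by integers $t\ge 0$. Conventions. $\|\cdot\|$ is the Euclidean norm; inequalities between symmetric matrices are in the positive semidefinite order. *)

(* Defs.v *)
From HB Require Import structures.
From mathcomp Require Import all_boot all_order all_algebra.
From mathcomp Require Import all_classical all_reals all_analysis.
From mathcomp Require Import complex.

Set Implicit Arguments.
Unset Strict Implicit.
Unset Printing Implicit Defensive.

Import Order.TTheory GRing.Theory Num.Theory.
Import numFieldNormedType.Exports.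

Local Open Scope classical_set_scope.
Local Open Scope ring_scope.

(* R^n is the type 'rV[R]_n, because the library's Jacobian acts on row
   vectors.  The library norm on matrices is the max norm, hence this one. *)
Definition eucl_norm (R : realType) n (v : 'rV[R]_n) : R :=
  Num.sqrt (\sum_(i < n) v 0 i ^+ 2).

(* The matrix of partial derivatives (d f_a / d x_b)_(a, b).  The library's
   'J f x satisfies 'd f x v = v *m 'J f x, so it is the transpose of it. *)
Definition Dmx (R : realType) n (f : 'rV[R]_n -> 'rV[R]_n) (x : 'rV[R]_n) :
  'M[R]_n := ('J f x)^T.

Definition continuously_differentiable (R : realType) n
    (f : 'rV[R]_n -> 'rV[R]_n) : Prop :=
  (forall x, differentiable f x) /\ continuous (Dmx f).

Definition psdmx (R : realType) n (A : 'M[R]_n) : Prop :=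
  A^T = A /\ forall v : 'cV[R]_n, 0 <= (v^T *m A *m v) 0 0.

Definition posdefmx (R : realType) n (A : 'M[R]_n) : Prop :=
  A^T = A /\ forall v : 'cV[R]_n, v != 0 -> 0 < (v^T *m A *m v) 0 0.

Definition psd_le (R : realType) n (A B : 'M[R]_n) : Prop := psdmx (B - A).

(* e j i means that (j, i) is an edge: node j sends information to node i. *)
Definition in_neighbors N (e : rel 'I_N) (i : 'I_N) : {set 'I_N} :=
  finset (fun j => e j i).

Definition strongly_connected N (e : rel 'I_N) : Prop :=
  forall i j : 'I_N, connect e i j.

Definition weight_matrix (R : realType) N (e : rel 'I_N) (W : 'M[R]_N) : Prop :=
  forall i j : 'I_N,
    (j \in i |: in_neighbors e i -> 0 < W i j) /\
    (j \notin i |: in_neighbors e i -> W i j = 0).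

Definition cplx_mx (R : realType) N (W : 'M[R]_N) : 'M[R[i]]_N :=
  map_mx (real_complex R) W.

Definition cmod (R : realType) (z : R[i]) : R := ComplexField.Normc.normc z.

Definition spectral_radius (R : realType) N (W : 'M[R]_N) : R :=
  sup [set cmod z | z in [set z : R[i] | eigenvalue (cplx_mx W) z]].

Definition ordered_eigenvalues (R : realType) N (W : 'M[R]_N)
    (lam : N.-tuple R[i]) : Prop :=
  char_poly (cplx_mx W) = \prod_(z <- lam) ('X - z%:P) /\
  sorted (fun a b => cmod b <= cmod a) lam.

Definition blended (R : realType) N n (p q : 'cV[R]_N)
    (f : 'I_N -> int -> 'rV[R]_n -> 'rV[R]_n) (t : int) (s : 'rV[R]_n) :
    'rV[R]_n :=
  \sum_(i < N) q i 0 *: f i t (p i 0 *: s).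

Definition contractive (R : realType) n (g : int -> 'rV[R]_n -> 'rV[R]_n) :
    Prop :=
  exists (H : 'M[R]_n) (gamma : R),
    [/\ posdefmx H, 0 < gamma < 1 &
      forall (t : int) (s : 'rV[R]_n),
        psd_le ((Dmx (g t) s)^T *m (H *m H) *m Dmx (g t) s)
               (gamma *: (H *m H))].

Definition bounded_lipschitz (R : realType) N n
    (f : 'I_N -> int -> 'rV[R]_n -> 'rV[R]_n) : Prop :=
  exists (M : R -> R) (L : R),
    [/\ {homo M : a b / a <= b}, continuous M, 0 <= L,
      forall i t x, eucl_norm (f i t x) <= M (eucl_norm x) &
      forall i t x y,
        eucl_norm (f i t x - f i t y) <= L * eucl_norm (x - y)].

(* Fractional times t + k / K, for t a natural number and k <= K, are counted
   in units of 1 / K, so that t_K and (t + 1)_0 are the same time. *)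
Definition frac_time (K t k : nat) : nat := (t * K + k)%N.

Definition multistep_solution (R : realType) N n (e : rel 'I_N) (W : 'M[R]_N)
    (f : 'I_N -> int -> 'rV[R]_n -> 'rV[R]_n) (K : nat)
    (x : nat -> 'I_N -> 'rV[R]_n) : Prop :=
  forall (t k : nat) (i : 'I_N), (k < K)%N ->
    x (frac_time K t k.+1) i =
      if k == 0%N then f i t%:Z (x (frac_time K t 0) i)
      else \sum_(j in i |: in_neighbors e i) W i j *: x (frac_time K t k) j.

Definition blended_solution (R : realType) n (g : int -> 'rV[R]_n -> 'rV[R]_n)
    (s : nat -> 'rV[R]_n) : Prop :=
  forall t : nat, s t.+1 = g t%:Z (s t).

Definition intermediate_bound (R : realType) (eps : R) (l : R[i]) (m : nat) :
    \bar R :=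
  if l == 0 then +oo%E else (eps / 2 * (1 + 1 / cmod l ^+ m))%:E.

(* Main.v *)
Require Import Defs.
From mathcomp Require Import all_boot all_order all_algebra.
From mathcomp Require Import all_classical all_reals all_analysis.
From mathcomp Require Import complex.
From mathcomp Require Import ring lra.
Import Order.TTheory GRing.Theory Num.Theory.
Import numFieldNormedType.Exports.
Local Open Scope classical_set_scope.
Local Open Scope ring_scope.

(* Put xi[t] = sum_i q_i x_i[t] and E[t] = sum_i |x_i[t] - p_i xi[t]|.  Since
   W^k -> p q^T at a rate r^k, the disagreement after a full period is at most
   delta = N C r^(K-1) times the total force sum_i |f_i(t, x_i[t])|, while xi
   follows the blended dynamics up to an error O(E).  The blended dynamics
   contracts the norm |v H|, so for small delta a small-gain argument bounds the
   total force ultimately by a constant independent of K and of the initial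
   conditions; hence E and |xi - s| are ultimately O(delta).  At the fractional
   time t_k the disagreement is at most C r^(k-1) times the force, and
   r^(k-1) = r^(K-1) / r^(K-k) yields the intermediate bound provided
   r >= |lambda_N|.  Such an r < 1 exists for N >= 2, because
   |lambda_N|^N <= |det W|, and det(W)^k = det(W^k) -> det(p q^T) = 0. *)

(** * The Euclidean norm *)

(** With [A], [B] the sums of squares and [S] the sum of products, the squares
    [(a i * B - b i * S) ^+ 2] add up to [B * (A * B - S ^+ 2)]. *)
Lemma cauchy_schwarz {R : realType} {I : finType} (a b : I -> R) :
  (\sum_i a i * b i) ^+ 2 <= (\sum_i a i ^+ 2) * (\sum_i b i ^+ 2).
Proof.
set S := \sum_i a i * b i; set A := \sum_i a i ^+ 2; set B := \sum_i b i ^+ 2.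
have B0 : 0 <= B by apply: sumr_ge0 => i _; exact: sqr_ge0.
have [B_eq0|B_neq0] := eqVneq B 0.
  have b0 i : b i = 0.
    apply/eqP; rewrite -sqrf_eq0 eq_le sqr_ge0 andbT -B_eq0 /B (bigD1 i) //=.
    by rewrite lerDl; apply: sumr_ge0 => j _; exact: sqr_ge0.
  by rewrite B_eq0 mulr0 /S big1 ?expr0n // => i _; rewrite b0 mulr0.
have Bpos : 0 < B by rewrite lt_def B_neq0.
have : 0 <= \sum_i (a i * B - b i * S) ^+ 2.
  by apply: sumr_ge0 => i _; exact: sqr_ge0.
have -> : \sum_i (a i * B - b i * S) ^+ 2 = B * (A * B - S ^+ 2).
  transitivity (\sum_i (B ^+ 2 * a i ^+ 2 - (2 * B * S) * (a i * b i)
                        + S ^+ 2 * b i ^+ 2)).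
    by apply: eq_bigr => i _; ring.
  by rewrite !big_split /= sumrN -!mulr_sumr -/A -/B -/S; ring.
by rewrite pmulr_rge0 // subr_ge0.
Qed.

Section EuclideanNorm.
Context {R : realType}.
Implicit Types n : nat.

Lemma eucl_norm_ge0 {n} (v : 'rV[R]_n) : 0 <= eucl_norm v.
Proof. exact: sqrtr_ge0. Qed.

Lemma sqr_eucl_norm {n} (v : 'rV[R]_n) :
  eucl_norm v ^+ 2 = \sum_(i < n) v 0 i ^+ 2.
Proof. by rewrite sqr_sqrtr //; apply: sumr_ge0 => i _; exact: sqr_ge0. Qed.

Lemma eucl_norm0 {n} : eucl_norm (0 : 'rV[R]_n) = 0.
Proof.
by rewrite /eucl_norm big1 ?sqrtr0 // => i _; rewrite mxE expr0n.
Qed.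

Lemma eucl_normZ {n} (a : R) (v : 'rV[R]_n) :
  eucl_norm (a *: v) = `|a| * eucl_norm v.
Proof.
rewrite /eucl_norm -sqrtr_sqr -sqrtrM ?sqr_ge0 // mulr_sumr.
by congr Num.sqrt; apply: eq_bigr => i _; rewrite mxE exprMn.
Qed.

Lemma eucl_dot_le {n} (u v : 'rV[R]_n) :
  (u *m v^T) 0 0 <= eucl_norm u * eucl_norm v.
Proof.
rewrite mxE; apply: le_trans (ler_norm _) _.
rewrite -(@ler_pXn2r _ 2) ?nnegrE ?mulr_ge0 ?eucl_norm_ge0 //.
rewrite -normrX ger0_norm ?sqr_ge0 // exprMn !sqr_eucl_norm.
apply: le_trans (cauchy_schwarz (u 0) (v 0)).
by rewrite le_eqVlt; apply/orP; left; apply/eqP; congr (_ ^+ 2); apply: eq_bigr => i _; rewrite mxE.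
Qed.

Lemma eucl_dotE {n} (u : 'rV[R]_n) : (u *m u^T) 0 0 = eucl_norm u ^+ 2.
Proof.
by rewrite sqr_eucl_norm mxE; apply: eq_bigr => i _; rewrite mxE expr2.
Qed.

Lemma eucl_normD {n} (u v : 'rV[R]_n) :
  eucl_norm (u + v) <= eucl_norm u + eucl_norm v.
Proof.
rewrite -(@ler_pXn2r _ 2) ?nnegrE ?addr_ge0 ?eucl_norm_ge0 //.
rewrite sqr_eucl_norm.
have -> : \sum_(i < n) (u + v) 0 i ^+ 2 = eucl_norm u ^+ 2 + eucl_norm v ^+ 2 + 2 * (u *m v^T) 0 0.
  rewrite !sqr_eucl_norm mxE mulr_sumr -!big_split /=.
  by apply: eq_bigr => i _; rewrite !mxE; ring.
by have := eucl_dot_le u v; lra.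
Qed.

End EuclideanNorm.

Lemma eucl_norm_sum {R : realType} {n} {I : finType} (F : I -> 'rV[R]_n) :
  eucl_norm (\sum_i F i) <= \sum_i eucl_norm (F i).
Proof.
elim/big_ind2: _ => [|x1 x2 y1 y2 h1 h2|//]; first by rewrite eucl_norm0.
exact: le_trans (eucl_normD _ _) (lerD h1 h2).
Qed.

Lemma eucl_norm_entry {R : realType} {n} (v : 'rV[R]_n) i : `|v 0 i| <= eucl_norm v.
Proof.
rewrite -sqrtr_sqr ler_sqrt; last by apply: sumr_ge0 => j _; exact: sqr_ge0.
by rewrite (bigD1 i) //= lerDl; apply: sumr_ge0 => j _; exact: sqr_ge0.
Qed.

Lemma eucl_norm_mulmx {R : realType} {n m} (A : 'M[R]_(n, m)) :
  exists2 c, 0 <= c & forall v : 'rV[R]_n, eucl_norm (v *m A) <= c * eucl_norm v.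
Proof.
exists (\sum_i eucl_norm (row i A)); first by apply: sumr_ge0 => i _; exact: eucl_norm_ge0.
move=> v; rewrite mulmx_sum_row; apply: le_trans (eucl_norm_sum _) _.
rewrite mulr_suml; apply: ler_sum => i _; rewrite eucl_normZ mulrC.
by rewrite ler_wpM2l ?eucl_norm_ge0 ?eucl_norm_entry.
Qed.

(** * Eventual bounds for real sequences *)

Lemma eventually_shift {P : nat -> Prop} :
  (\forall t \near \oo, P t) -> \forall t \near \oo, P t.+1.
Proof. by move=> [m _ mP]; exists m => //= t mt; apply: mP => /=; exact: leqW. Qed.

Lemma eventually_unshift {P : nat -> Prop} :
  (\forall t \near \oo, P t.+1) -> \forall t \near \oo, P t.
Proof. by move=> [m _ mP]; exists m.+1 => //= -[//|t] mt; exact: mP. Qed.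

(** The excess of [u] over the fixed point [c / (1 - g)] is dominated by a geometric sequence; the
    strict hypothesis places [B] above that fixed point. *)
Lemma affine_recurrence_le {R : realType} (u : nat -> R) (g c B : R) :
  0 <= g -> g < 1 -> c < (1 - g) * B ->
  (\forall t \near \oo, u t.+1 <= g * u t + c) -> \forall t \near \oo, u t <= B.
Proof.
move=> g0 g1 cB [t0 _ ht].
have g1' : 0 < 1 - g by lra.
pose b := c / (1 - g).
have bE : g * b + c = b by rewrite /b; field; rewrite gt_eqF.
have bB : b < B by rewrite /b ltr_pdivrMr // mulrC.
have step k : u (t0 + k)%N - b <= g ^+ k * (u t0 - b).
  elim: k => [|k IH]; first by rewrite addn0 expr0 mul1r.
  rewrite addnS exprS -mulrA.
  have /= := ht (t0 + k)%N (leq_addr _ _).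
  have := ler_wpM2l g0 IH; lra.
have gk : (fun k => g ^+ k * (u t0 - b)) @ \oo --> 0.
  rewrite -(mul0r (u t0 - b)); apply: cvgMl; apply: cvg_expr.
  by rewrite ger0_norm.
have [k0 _ hk] := cvgr_lt 0 gk (B - b) ltac:(by rewrite subr_gt0).
exists (t0 + k0)%N => //= t ht'.
have := step (t - t0)%N; rewrite subnKC; last by apply: leq_trans ht'; exact: leq_addr.
have /= := hk (t - t0)%N; rewrite leq_subRL; last by apply: leq_trans ht'; exact: leq_addr.
move/(_ ht'); lra.
Qed.

Lemma limn_esup_le_near {R : realType} (u : nat -> R) (c : R) :
  (\forall t \near \oo, u t <= c) -> (limn_esup (fun t => (u t)%:E) <= c%:E)%E.
Proof.
move=> [m _ hm]; rewrite limn_esup_lim; apply: lime_le; first exact: is_cvg_esups.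
exists m => //= k mk; apply: ge_ereal_sup => _ [l /= kl <-].
by rewrite lee_fin; apply: hm => /=; exact: leq_trans kl.
Qed.

(** * Powers of the weight matrix *)

Section PerronMatrix.
Context {R : realType} {N : nat} {W : 'M[R]_N} {p q : 'cV[R]_N}.
Hypotheses (p_gt0 : forall i, 0 < p i 0) (q_gt0 : forall i, 0 < q i 0).
Hypotheses (Wp : W *m p = p) (qW : q^T *m W = q^T) (qp : q^T *m p = 1%:M).

Lemma expmxS (k : nat) : W ^+ k.+1 = W *m W ^+ k.
Proof. by rewrite exprS. Qed.

Lemma expmxSr (k : nat) : W ^+ k.+1 = W ^+ k *m W.
Proof. by rewrite exprSr. Qed.

Lemma expmx_fix (k : nat) : W ^+ k *m p = p.
Proof. by elim: k => [|k IH]; rewrite ?mul1mx // expmxSr -mulmxA Wp. Qed.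

Lemma fix_expmx (k : nat) : q^T *m W ^+ k = q^T.
Proof. by elim: k => [|k IH]; rewrite ?mulmx1 // expmxS mulmxA qW. Qed.

Lemma expmx_ge0 (k : nat) :
  (forall i j, 0 <= W i j) -> forall i j, 0 <= (W ^+ k) i j.
Proof.
move=> W0; elim: k => [|k IH] i j; first by rewrite expr0 mxE ler0n.
by rewrite expmxS mxE sumr_ge0 // => l _; rewrite mulr_ge0.
Qed.

(* Subtracting alpha p q^T leaves a nonnegative matrix whose weighted row sums
   are 1 - alpha, and does not change the action on the hyperplane q^T v = 0. *)
Lemma doeblin_contraction (A : 'M[R]_N) (alpha c : R) (v : 'cV[R]_N) :
  A *m p = p -> (forall i j, alpha * (p i 0 * q j 0) <= A i j) ->
  q^T *m v = 0 -> (forall i, `|v i 0| <= c * p i 0) ->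
  forall i, `|(A *m v) i 0| <= (1 - alpha) * c * p i 0.
Proof.
move=> Ap hA qv hv i.
have sum_qv : \sum_j q j 0 * v j 0 = 0.
  have /matrixP/(_ 0 0) := qv; rewrite !mxE => qv0; rewrite -[RHS]qv0.
  by apply: eq_bigr => j _; rewrite mxE.
have sum_qp : \sum_j q j 0 * p j 0 = 1.
  have /matrixP/(_ 0 0) := qp; rewrite !mxE /= => qp0; rewrite -[RHS]qp0.
  by apply: eq_bigr => j _; rewrite mxE.
have sum_Ap : \sum_j A i j * p j 0 = p i 0.
  by have /matrixP/(_ i 0) := Ap; rewrite mxE.
have -> : (A *m v) i 0 = \sum_j (A i j - alpha * (p i 0 * q j 0)) * v j 0.
  transitivity (\sum_j A i j * v j 0 - alpha * p i 0 * \sum_j q j 0 * v j 0).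
    by rewrite sum_qv mulr0 subr0 mxE.
  by rewrite mulr_sumr -sumrB; apply: eq_bigr => j _; ring.
apply: le_trans (ler_norm_sum _ _ _) _.
apply: (@le_trans _ _ (\sum_j (A i j - alpha * (p i 0 * q j 0)) * (c * p j 0))).
  by apply: ler_sum => j _; rewrite normrM ger0_norm ?subr_ge0 // ler_wpM2l ?subr_ge0.
rewrite le_eqVlt; apply/orP; left; apply/eqP.
transitivity (c * (\sum_j A i j * p j 0) - alpha * c * p i 0 * (\sum_j q j 0 * p j 0)).
  by rewrite !mulr_sumr -sumrB; apply: eq_bigr => j _; ring.
by rewrite sum_Ap sum_qp; ring.
Qed.

(** Since [W] fixes [q^T], all iterates of [v] stay in the hyperplane, so each block of [m] steps
    gains the factor [1 - alpha]; each of the [r] leftover steps is the case [alpha = 0] and loses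
    nothing. *)
Lemma expmx_block_decay (m : nat) (alpha c : R) (v : 'cV[R]_N) :
  (forall i j, 0 <= W i j) ->
  (forall i j, alpha * (p i 0 * q j 0) <= (W ^+ m) i j) ->
  q^T *m v = 0 -> (forall i, `|v i 0| <= c * p i 0) ->
  forall d r i, `|(W ^+ (r + d * m) *m v) i 0| <= (1 - alpha) ^+ d * c * p i 0.
Proof.
move=> W0 hm qv hv.
have qWv k : q^T *m (W ^+ k *m v) = 0 by rewrite mulmxA fix_expmx.
elim=> [|d IHd].
  elim=> [|r IHr] i; first by rewrite expr0 mul1mx mul1r.
  rewrite addSn expmxS -mulmxA.
  apply: le_trans (doeblin_contraction _ 0 _ _ Wp _ (qWv _) IHr i) _.
    by move=> ? ?; rewrite mul0r.
  by rewrite subr0 mul1r.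
elim=> [|r IHr] i.
  rewrite add0n mulSn exprD -[_ * _]/(_ *m _) -mulmxA.
  have /= IH0 := IHd 0%N; rewrite add0n in IH0.
  have := doeblin_contraction _ alpha _ _ (expmx_fix m) hm (qWv _) IH0 i.
  by rewrite exprS !mulrA.
rewrite addSn expmxS -mulmxA.
apply: le_trans (doeblin_contraction _ 0 _ _ Wp _ (qWv _) IHr i) _.
  by move=> ? ?; rewrite mul0r.
by rewrite subr0 mul1r.
Qed.

Lemma positive_lower_bound {I : finType} (F : I -> R) :
  (forall x, 0 < F x) -> exists2 a : R, 0 < a < 1 & forall x, a <= F x.
Proof.
(* The summand 2 keeps [s^-1] below 1, also for an empty [I]. *)
move=> F0; pose s := 2 + \sum_x (F x)^-1.
have sum0 : 0 <= \sum_x (F x)^-1 by apply: sumr_ge0 => x _; rewrite invr_ge0 ltW.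
have s0 : 1 < s by rewrite /s; lra.
have s0' : 0 < s by lra.
exists s^-1; first by rewrite invr_gt0 s0' invf_lt1.
move=> x; rewrite -[leRHS]invrK lef_pV2 ?posrE ?invr_gt0 //.
rewrite /s (bigD1 x) //= addrCA lerDl addr_ge0 //.
by apply: sumr_ge0 => y _; rewrite invr_ge0 ltW.
Qed.

(** The difference is [W ^+ k *m (1 - p q^T)], and [q^T] annihilates the columns of [1 - p q^T], so
    block decay applies to each of them. *)
Lemma expmx_rank1_decay (m : nat) :
  (forall i j, 0 <= W i j) -> (forall i j, 0 < (W ^+ m.+1) i j) ->
  exists C r : R, [/\ 0 <= C, 0 < r < 1 &
    forall k i j, `|(W ^+ k - p *m q^T) i j| <= C * r ^+ k].
Proof.
move=> W0 Wm.
have [alpha /andP[a0 a1] halpha] := positive_lower_bound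
  (fun x : 'I_N * 'I_N => (W ^+ m.+1) x.1 x.2 / (p x.1 0 * q x.2 0))
  ltac:(by move=> x; rewrite divr_gt0 // mulr_gt0).
have hm i j : alpha * (p i 0 * q j 0) <= (W ^+ m.+1) i j.
  by rewrite -ler_pdivlMr ?mulr_gt0 //; exact: (halpha (i, j)).
pose V := 1%:M - p *m q^T.
pose c0 := \sum_i \sum_j `|V i j| / p i 0.
have V0 i j : 0 <= `|V i j| / p i 0 by rewrite divr_ge0 // ltW.
have c00 : 0 <= c0 by apply: sumr_ge0 => i _; apply: sumr_ge0.
have hV i j : `|V i j| <= c0 * p i 0.
  rewrite -ler_pdivrMr // /c0 (bigD1 i) //= (bigD1 j) //= -addrA lerDl.
  by rewrite addr_ge0 // sumr_ge0 // => l _; apply: sumr_ge0.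
have qV j : q^T *m col j V = 0.
  by rewrite colE mulmxA mulmxBr mulmx1 mulmxA qp mul1mx subrr mul0mx.
have WV k : W ^+ k - p *m q^T = W ^+ k *m V.
  by rewrite mulmxBr mulmx1 mulmxA expmx_fix.
(* The root spreads the gain of a block evenly over its [m.+1] steps. *)
pose r := (1 - alpha) `^ (m.+1%:R^-1).
have rm : r ^+ m.+1 = 1 - alpha.
  rewrite -powR_mulrn ?powR_ge0 // -powRrM mulVf ?pnatr_eq0 // powRr1 //; lra.
have r0 : 0 < r by rewrite powR_gt0; lra.
have r1 : r < 1.
  rewrite ltNge; apply/negP => /(exprn_ege1 m.+1); rewrite rm; lra.
pose sp := \sum_i p i 0.
have sp0 : 0 <= sp by apply: sumr_ge0 => i _; exact: ltW.
(* Dividing by [r ^+ m.+1] pays for the incomplete block among the [k] steps; [sp] bounds every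
   [p i 0]. *)
exists (c0 * sp / r ^+ m.+1), r; split.
- by rewrite divr_ge0 ?mulr_ge0 // exprn_ge0 // ltW.
- by rewrite r0.
move=> k i j; rewrite WV.
have -> : (W ^+ k *m V) i j = (W ^+ k *m col j V) i 0.
  by rewrite mxE [RHS]mxE; apply: eq_bigr => l _; rewrite [in RHS]mxE.
rewrite [in X in X <= _](divn_eq k m.+1) addnC.
apply: le_trans (expmx_block_decay m.+1 alpha c0 (col j V) W0 hm (qV j) _ _ _ i) _.
  by move=> l; rewrite mxE.
rewrite -rm -exprM.
have -> : c0 * sp / r ^+ m.+1 * r ^+ k = (r ^+ k / r ^+ m.+1) * c0 * sp.
  move: (r ^+ m.+1)^-1 (r ^+ k) => a b; ring.
have pi_sp : p i 0 <= sp.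
  by rewrite /sp (bigD1 i) //= lerDl sumr_ge0 // => l _; exact: ltW.
apply: ler_pM => //; [|exact: ltW|].
  by rewrite mulr_ge0 // exprn_ge0 // ltW.
rewrite ler_wpM2r // ler_pdivlMr ?exprn_gt0 // -exprD.
apply: ler_wiXn2l; [exact: ltW|exact: ltW|].
rewrite [leqLHS](divn_eq k m.+1) mulnC leq_add2l ltnW // ltn_mod //.
Qed.

End PerronMatrix.

(** * Primitivity of the weight matrix *)

Section WeightMatrix.
Context {R : realType} {N : nat} {e : rel 'I_N} {W : 'M[R]_N}.
Hypothesis W_weights : weight_matrix e W.

Lemma weight_diag_gt0 i : 0 < W i i.
Proof. by apply: (W_weights i i).1; rewrite !inE eqxx. Qed.

Lemma weight_edge_gt0 i j : e j i -> 0 < W i j.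
Proof. by move=> eji; apply: (W_weights i j).1; rewrite !inE eji orbT. Qed.

Lemma weight_ge0 i j : 0 <= W i j.
Proof.
have [/(W_weights i j).1/ltW //|/(W_weights i j).2 ->//] :=
  boolP (j \in i |: in_neighbors e i).
Qed.

Lemma weight_sum {V : lmodType R} (F : 'I_N -> V) i :
  \sum_(j in i |: in_neighbors e i) W i j *: F j = \sum_j W i j *: F j.
Proof.
rewrite [RHS](bigID (fun j => j \in i |: in_neighbors e i)) /=.
by rewrite [X in _ + X]big1 ?addr0 // => j /(W_weights i j).2 ->; rewrite scale0r.
Qed.

Lemma weight_mul_gt0 (A B : 'M[R]_N) i j l :
  (forall i j, 0 <= A i j) -> (forall i j, 0 <= B i j) ->
  0 < A i l -> 0 < B l j -> 0 < (A *m B) i j.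
Proof.
move=> A0 B0 Ail Blj; rewrite mxE (bigD1 l) //= ltr_pwDl ?mulr_gt0 //.
by rewrite sumr_ge0 // => h _; rewrite mulr_ge0.
Qed.

(** The positive diagonal of [W] lets a walk wait at its end node [i]. *)
Lemma weight_power_mono i j k d : 0 < (W ^+ k) i j -> 0 < (W ^+ (d + k)) i j.
Proof.
move=> h; elim: d => [//|d IH]; rewrite addSn expmxS.
apply: (weight_mul_gt0 _ _ _ _ i) => //; first exact: weight_ge0.
  exact/expmx_ge0/weight_ge0.
exact: weight_diag_gt0.
Qed.

(** [W i j] weighs the edge from [j] to [i], so a walk starting at [j] contributes to column [j], in
    the row of its last node. *)
Lemma weight_path_gt0 (s : seq 'I_N) j :
  path e j s -> 0 < (W ^+ size s) (last j s) j.
Proof.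
elim: s j => [|y s IH] j /=; first by rewrite expr0 mxE eqxx ltr01.
move=> /andP[ejy /IH h]; rewrite expmxSr.
apply: (weight_mul_gt0 _ _ _ _ y) => //; last exact: weight_edge_gt0.
  exact/expmx_ge0/weight_ge0.
exact: weight_ge0.
Qed.

(** Every pair of nodes has a connecting walk of its own length; waiting extends all of them to one
    common length. *)
Lemma weight_primitive :
  strongly_connected e -> exists m, forall i j, 0 < (W ^+ m.+1) i j.
Proof.
move=> e_conn.
have /fin_all_exists[k hk] : forall x : 'I_N * 'I_N, exists k, 0 < (W ^+ k) x.1 x.2.
  move=> [i j] /=; have /connectP[s es ->] := e_conn j i.
  by exists (size s); exact: weight_path_gt0.
exists (\max_x k x)%N => i j.
have km := leq_bigmax (F := k) (i, j).
by rewrite -(subnK (leqW km)); apply: weight_power_mono; exact: (hk (i, j)).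
Qed.

End WeightMatrix.

(** * The eigenvalue of smallest modulus *)

Section SmallestEigenvalue.
Context {R : realType} {N : nat}.
Implicit Types W : 'M[R]_N.

Lemma cvg_det {T : Type} {F : set_system T} {FF : Filter F}
    (A : T -> 'M[R]_N) (B : 'M[R]_N) :
  (forall i j, A t i j @[t --> F] --> B i j) -> \det (A t) @[t --> F] --> \det B.
Proof.
move=> AB; apply: cvg_big => [|s _]; first exact: add_continuous.
apply: cvgM; first exact: cvg_cst.
by apply: cvg_big => [|i _]; [exact: mul_continuous|exact: AB].
Qed.

Lemma det_expmx W k : \det (W ^+ k) = \det W ^+ k.
Proof. by elim: k => [|k IH]; rewrite ?det1 // expmxS det_mulmx IH exprS. Qed.

Lemma det_lt1_of_rank1_limit W (p q : 'cV[R]_N) (C r : R) :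
  (1 < N)%N -> 0 < r < 1 ->
  (forall k i j, `|(W ^+ k - p *m q^T) i j| <= C * r ^+ k) -> `|\det W| < 1.
Proof.
move=> N1 /andP[r0 r1] decay.
have det0 : \det (p *m q^T) = 0.
  (* If [p *m q^T] were invertible, its rank [N] would be at most 1. *)
  apply/eqP; apply: contraLR N1 => detN0.
  have : p *m q^T \in unitmx by rewrite unitmxE unitfE.
  rewrite -row_full_unit -leqNgt => /eqP <-.
  exact: leq_trans (mulmx_max_rank _ _) _.
have Crk : (fun k => C * r ^+ k) @ \oo --> 0.
  by rewrite -(mulr0 C); apply: cvgMr; apply: cvg_expr; rewrite ger0_norm // ltW.
have Wk i j : (fun k => (W ^+ k) i j) @ \oo --> (p *m q^T) i j.
  apply/cvgrPdist_le => eps eps0.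
  have [k0 _ hk] := cvgr_le 0 Crk eps eps0.
  exists k0 => //= k /hk /=; apply: le_trans.
  by have := decay k i j; rewrite distrC !mxE.
have detk : (fun k => `|\det W| ^+ k) @ \oo --> 0.
  rewrite -(normr0 R) -det0.
  under eq_fun => k do rewrite -normrX -det_expmx.
  by apply: cvg_norm; exact: cvg_det.
rewrite ltNge; apply/negP => detge1.
have [k0 _ hk] := cvgr_lt 0 detk 1 ltr01.
by have /= := hk k0 (leqnn _); rewrite ltNge exprn_ege1.
Qed.

Lemma cmod_prod (s : seq R[i]) : cmod (\prod_(z <- s) z) = \prod_(z <- s) cmod z.
Proof.
elim: s => [|z s IH]; rewrite ?big_nil ?big_cons; first exact: ComplexField.Normc.normc1.
by rewrite -IH; exact: ComplexField.Normc.normcM.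
Qed.

Lemma cmod_real (x : R) : cmod (real_complex R x) = `|x|.
Proof. by rewrite /cmod /= expr0n addr0 sqrtr_sqr. Qed.

Lemma cmod_ge0 (z : R[i]) : 0 <= cmod z.
Proof. by case: z => a b; exact: sqrtr_ge0. Qed.

Lemma cmod_gt0 (z : R[i]) : z != 0 -> 0 < cmod z.
Proof.
move=> z0; rewrite lt_def cmod_ge0 andbT; apply: contra z0 => /eqP.
by move/ComplexField.Normc.eq0_normc => ->.
Qed.

(** Both sides come from the constant coefficient of the characteristic polynomial. *)
Lemma prod_eigenvalues W (lam : N.-tuple R[i]) :
  ordered_eigenvalues W lam -> \prod_(z <- lam) cmod z = `|\det W|.
Proof.
move=> [lamW _]; rewrite -cmod_prod.
have := char_poly_det (cplx_mx W).
rewrite lamW -horner_coef0 horner_prod det_map_mx /=.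
under eq_bigr => z _ do rewrite !hornerE.
have -> : \prod_(z <- lam) - z = (-1) ^+ N * \prod_(z <- lam) z.
  under eq_bigr => z _ do rewrite -mulN1r.
  by rewrite big_split /= big_const_seq count_predT size_tuple -Monoid.iteropE.
by move/(mulfI (negbT (signr_eq0 _ _))) ->; rewrite cmod_real.
Qed.

(** The moduli are sorted, so if the last were at least 1, all would be, and so would their
    product. *)
Lemma last_eigenvalue_lt1 W (lam : N.-tuple R[i]) :
  (0 < N)%N -> ordered_eigenvalues W lam -> `|\det W| < 1 ->
  cmod lam`_(N.-1) < 1.
Proof.
move=> N0 lamW; rewrite -(prod_eigenvalues _ _ lamW) => prod1.
rewrite ltNge; apply/negP => lam1; move: prod1; apply/negP; rewrite -leNgt.
rewrite big_seq; apply: (big_ind (fun x : R => 1 <= x)) => // [x y x1 y1|z].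
  by rewrite -[1]mulr1 ler_pM.
move=> zlam; apply: le_trans lam1 _.
have tr : transitive (fun a b : R[i] => cmod b <= cmod a).
  by move=> b a c ab bc; exact: le_trans bc ab.
have rf : reflexive (fun a b : R[i] => cmod b <= cmod a) by move=> a; exact: lexx.
rewrite -(nth_index 0 zlam).
have zN : (index z lam < N)%N by rewrite -[X in (_ < X)%N](size_tuple lam) index_mem.
apply: (sorted_leq_nth tr rf 0 lamW.2); rewrite ?inE ?size_tuple //.
  by rewrite prednK.
by rewrite -ltnS prednK.
Qed.

End SmallestEigenvalue.

(** A decay rate may be enlarged below 1, hence raised to dominate the last eigenvalue; the
    alternative [C = 0] takes in [N <= 1], where no such rate need exist. *)
Lemma expmx_decay {R : realType} {N : nat} {e : rel 'I_N} {W : 'M[R]_N}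
    {lam : N.-tuple R[i]} {p q : 'cV[R]_N} :
  (forall i, 0 < p i 0) -> (forall i, 0 < q i 0) ->
  W *m p = p -> q^T *m W = q^T -> q^T *m p = 1%:M ->
  weight_matrix e W -> strongly_connected e -> ordered_eigenvalues W lam ->
  exists C r : R, [/\ 0 <= C, 0 < r < 1,
    forall k i j, `|(W ^+ k - p *m q^T) i j| <= C * r ^+ k &
    C = 0 \/ cmod lam`_(N.-1) <= r].
Proof.
move=> p0 q0 Wp qW qp wW conn lamW.
have [N1|N1] := leqP N 1.
  (* For N = 1 the eigenvalue lambda_N is 1, but W = p q^T = 1. *)
  exists 0, 2^-1; split => //; first by apply/andP; split; lra.
  - move=> k i j.
    suff -> : W ^+ k = p *m q^T by rewrite mul0r subrr mxE normr0.
    clear lamW wW conn lam.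
    case: N N1 e W p q p0 q0 Wp qW qp i j => [|[|//]] _ e W p q p0 q0 Wp qW qp i j.
      by case: i.
    have pq1 : p *m q^T = 1%:M.
      by apply/matrixP=> a b; have /matrixP/(_ a b) := qp; rewrite !mxE !big_ord1 !mxE !ord1 mulrC.
    by rewrite -[LHS]mulmx1 -pq1 mulmxA expmx_fix.
  - by left.
have [m Wm] := weight_primitive wW conn.
have [C [r [C0 r01 decay]]] :=
  expmx_rank1_decay p0 q0 Wp qW qp m (weight_ge0 wW) Wm.
have lam1 := last_eigenvalue_lt1 _ _ (ltnW N1) lamW
  (det_lt1_of_rank1_limit _ _ _ _ _ N1 r01 decay).
have /andP[r0 r1] := r01.
exists C, (Num.max r (cmod lam`_(N.-1))); split => //.
- by rewrite lt_max r0 gt_max r1.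
- move=> k i j; apply: le_trans (decay k i j) _.
  by rewrite ler_wpM2l // lerXn2r ?nnegrE ?le_max ?(ltW r0) ?lexx.
- by right; rewrite le_max lexx orbT.
Qed.

(** * Contraction of the blended dynamics *)

Section Contraction.
Context {R : realType} {n : nat}.

(** This scalar function is what the mean value theorem is applied to; its difference quotient is a
    combination of the coordinates of that of [g] in direction [d]. *)
Lemma is_derive_along_line (g : 'rV[R]_n -> 'rV[R]_n) (b d : 'rV[R]_n)
    (u : 'cV[R]_n) (c : R) : differentiable g (b + c *: d) ->
  is_derive c 1 (fun h : R => (g (b + h *: d) *m u) 0 0)
    ((d *m ('J g (b + c *: d)) *m u) 0 0).
Proof.
move=> dg; pose x := b + c *: d.
have /diff_derivable-/(_ d) dx := dg.
have cv : (fun h : R => h^-1 *: ((g \o shift x) (h *: d) - g x)) @ 0^' --> d *m 'J g x.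
  by rewrite -deriveEjacobian.
pose phi (h : R) : R := (g (b + h *: d) *m u) 0 0.
have cvphi : (fun h : R => h^-1 *: ((phi \o shift c) (h *: 1) - phi c)) @ 0^'
    --> (d *m 'J g x *m u) 0 0.
  have -> : (fun h : R => h^-1 *: ((phi \o shift c) (h *: 1) - phi c)) =
    (fun h : R => \sum_j (h^-1 *: ((g \o shift x) (h *: d) - g x)) 0 j * u j 0).
    apply/funext => h; rewrite /phi /= /x.
    have -> : b + (h *: 1 + c) *: d = h *: d + (b + c *: d).
      by rewrite scalerDl addrCA [h *: 1]mulr1.
    rewrite !mxE -sumrB scaler_sumr; apply: eq_bigr => j _.
    by rewrite !mxE -[in RHS]mulrA mulrBl.
  rewrite mxE; apply: cvg_big => [|j _]; first exact: add_continuous.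
  apply: cvgMl.
  exact: (cvg_comp _ _ cv (@coord_continuous R 1 n 0 j (d *m 'J g x))).
by apply: DeriveDef; [apply/cvg_ex; exists ((d *m 'J g x *m u) 0 0)|exact: cvg_lim].
Qed.

(* Mean value theorem for s |-> <g s, H^2 w> on [b, a], with w = g a - g b. *)
Lemma contraction_of_jacobian (g : 'rV[R]_n -> 'rV[R]_n) (H : 'M[R]_n) (gamma : R) :
  H^T = H -> 0 <= gamma -> (forall x, differentiable g x) ->
  (forall x, psd_le ((Dmx g x)^T *m (H *m H) *m Dmx g x) (gamma *: (H *m H))) ->
  forall a b, eucl_norm ((g a - g b) *m H) <=
    Num.sqrt gamma * eucl_norm ((a - b) *m H).
Proof.
move=> HT g0 dg hpsd a b.
pose d := a - b; pose w := g a - g b; pose u := H *m H *m w^T.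
have HHE (y z : 'rV[R]_n) : y *m (H *m H *m z^T) = y *m H *m (z *m H)^T.
  by rewrite trmx_mul HT !mulmxA.
(* The matrix inequality evaluated at [d] bounds the Jacobian in the norm [v H]. *)
have JH x : eucl_norm (d *m 'J g x *m H) <= Num.sqrt gamma * eucl_norm (d *m H).
  rewrite -(@ler_pXn2r _ 2) ?nnegrE ?mulr_ge0 ?sqrtr_ge0 ?eucl_norm_ge0 //.
  rewrite exprMn (sqr_sqrtr g0) -!eucl_dotE.
  have := (hpsd x).2 d^T; rewrite trmxK /Dmx trmxK.
  have -> : d *m (gamma *: (H *m H) - 'J g x *m (H *m H) *m ('J g x)^T) *m d^T =
    gamma *: (d *m H *m (d *m H)^T) - d *m 'J g x *m H *m (d *m 'J g x *m H)^T.
    rewrite mulmxBr mulmxBl -scalemxAr -scalemxAl -!HHE trmx_mul !mulmxA.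
    by [].
  by rewrite !mxE subr_ge0.
pose phi (h : R) : R := (g (b + h *: d) *m u) 0 0.
have dphi (c : R) : is_derive c 1 phi ((d *m ('J g (b + c *: d)) *m u) 0 0).
  exact: is_derive_along_line.
have cphi : {within `[0, 1], continuous phi}.
  by apply: derivable_within_continuous => x _; case: (dphi x).
have [c _] := MVT_segment ler01 (fun x _ => dphi x) cphi.
have bd : b + d = a by rewrite /d addrC subrK.
rewrite /phi subr0 mulr1 scale1r scale0r addr0 bd.
(* The choice of [u] turns the increment of [phi] into a square, so that after Cauchy-Schwarz one
   factor [eucl_norm (w *m H)] cancels. *)
have -> : (g a *m u) 0 0 - (g b *m u) 0 0 = eucl_norm (w *m H) ^+ 2.
  by rewrite -eucl_dotE -HHE -/u /w mulmxBl !mxE.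
rewrite /u HHE => eqw.
have := eucl_dot_le (d *m 'J g (b + c *: d) *m H) (w *m H); rewrite -eqw expr2.
have [->|w0] := eqVneq (eucl_norm (w *m H)) 0.
  by move=> _; rewrite mulr_ge0 ?sqrtr_ge0 ?eucl_norm_ge0.
rewrite ler_pM2r; last by rewrite lt_def w0 eucl_norm_ge0.
by move/le_trans; apply; exact: JH.
Qed.

Lemma posdef_unitmx (H : 'M[R]_n) : posdefmx H -> H \in unitmx.
Proof.
move=> [HT Hpos]; rewrite -row_free_unit -kermx_eq0.
apply/rowV0P => v /sub_kermxP vH; apply/eqP; apply: contraT => v0.
have /= := Hpos v^T; rewrite trmxK vH mul0mx mxE ltxx.
by apply; apply: contra v0 => /eqP vT; rewrite -[v]trmxK vT trmx0.
Qed.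

Lemma blended_differentiable {N : nat} (p q : 'cV[R]_N)
    (f : 'I_N -> int -> 'rV[R]_n -> 'rV[R]_n) (t : int) :
  (forall i x, differentiable (f i t) x) ->
  forall x, differentiable (blended p q f t) x.
Proof.
move=> df x.
have -> : blended p q f t = \sum_i (fun s => q i 0 *: f i t (p i 0 *: s)).
  by apply/funext => s; rewrite fct_sumE.
elim/big_ind: _ => [|g h dg dh|i _]; first exact: differentiable_cst.
  exact: differentiableD.
apply: differentiableZ; apply: differentiable_comp; last exact: df.
exact: differentiableZ.
Qed.

End Contraction.

(** * Multi-step coupling *)

(* Small gain: U + beta E is a Lyapunov function, since E only feeds back into
   itself and into U through the small factor delta. *)
Lemma small_gain_ultimate_bound {R : realType} {g c0 c1 m0 l1 L : R} :
  0 <= g < 1 -> 0 <= c0 -> 0 <= c1 -> 0 <= m0 -> 0 <= l1 -> 0 <= L ->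
  exists delta0 B : R, [/\ 0 < delta0, 0 <= B &
    forall (delta : R) (U E S : nat -> R), 0 <= delta <= delta0 ->
      (forall t, 0 <= U t) -> (forall t, 0 <= E t) ->
      (forall t, S t <= m0 + l1 * U t + L * E t) ->
      (forall t, E t.+1 <= delta * S t) ->
      (forall t, U t.+1 <= g * U t + c0 + c1 * E t) ->
      \forall t \near \oo, S t <= B].
Proof.
move=> /andP[g0 g1] c00 c10 m00 l10 L0.
(* [beta] is large enough to absorb [c1 * E] into a quarter of [beta * E]; [w] collects all that
   [delta] must make small. *)
pose beta := 4 * c1 + 1; pose w := 1 + beta * l1 + 4 * L.
have b1 : 1 <= beta by rewrite /beta; lra.
have bl : 0 <= beta * l1 by apply: mulr_ge0 => //; lra.
have w1 : 1 <= w by rewrite /w; lra.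
(* The fixed point of the Lyapunov recurrence with rate [(1 + g) / 2] and constant [c0 + beta * m0],
   plus 1 for strictness. *)
pose Z := 2 / (1 - g) * (c0 + beta * m0) + 1.
have bm : 0 <= beta * m0 by apply: mulr_ge0 => //; lra.
have Z0 : 0 <= Z.
  by rewrite /Z addr_ge0 // mulr_ge0 //; [apply: divr_ge0; lra|lra].
exists ((1 - g) / 2 / w), (m0 + (l1 + L) * Z); split.
- by apply: divr_gt0; lra.
- by rewrite addr_ge0 // mulr_ge0 // addr_ge0.
move=> delta U E S /andP[d0 d1] U0 E0 hS hE hU.
have dw : delta * w <= (1 - g) / 2 by rewrite -ler_pdivlMr //; lra.
have dbl : 0 <= delta * (beta * l1) by rewrite mulr_ge0.
have dL : 0 <= delta * L by rewrite mulr_ge0.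
have [dl1 dL1 dl] : [/\ delta * (beta * l1) <= (1 - g) / 2,
    delta * L <= 1 / 4 & delta <= 1].
  by move: dw; rewrite /w !mulrDr mulr1 => dw; split; lra.
have lyap : \forall t \near \oo, U t + beta * E t <= Z.
  apply: (affine_recurrence_le (fun t => U t + beta * E t)
    ((1 + g) / 2) (c0 + beta * m0)); [lra|lra| |].
    rewrite /Z mulrDr mulrA.
    have -> : (1 - (1 + g) / 2) * (2 / (1 - g)) = 1.
      by field; rewrite gt_eqF //; lra.
    by rewrite mul1r ltrDl; lra.
  near=> t.
  have Et : beta * E t.+1 <= beta * (delta * (m0 + l1 * U t + L * E t)).
    by rewrite ler_wpM2l //; [lra|apply: le_trans (hE t) _; rewrite ler_wpM2l].
  have e1 : beta * (delta * (m0 + l1 * U t + L * E t)) =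
    delta * (beta * m0) + delta * (beta * l1) * U t + (delta * L) * (beta * E t).
    by ring.
  have t1 : delta * (beta * m0) <= beta * m0 by apply: ler_piMl.
  have t2 : delta * (beta * l1) * U t <= (1 - g) / 2 * U t by apply: ler_wpM2r.
  have bE : 0 <= beta * E t by apply: mulr_ge0 => //; lra.
  have t3 : (delta * L) * (beta * E t) <= 1 / 4 * (beta * E t).
    exact: ler_wpM2r.
  have t4 : c1 * E t <= 1 / 4 * (beta * E t).
    by rewrite mulrA ler_wpM2r // /beta; lra.
  (* The [U] terms add up to the rate [g + (1 - g) / 2], which is [(1 + g) / 2]; the [E] terms have
     rate [1 / 4 + 1 / 4], which is no larger. *)
  have t5 : 1 / 2 * (beta * E t) <= (1 + g) / 2 * (beta * E t).
    by apply: ler_wpM2r => //; lra.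
  by have := hU t; lra.
near=> t.
have Zt : U t + beta * E t <= Z by near: t.
have EbE : E t <= beta * E t by apply: ler_peMl.
apply: le_trans (hS t) _; rewrite -addrA lerD2l mulrDl.
have Ut0 := U0 t; have Et0 := E0 t.
by apply: lerD; apply: ler_wpM2l => //; lra.
Unshelve. all: by end_near.
Qed.

(** * Mean, disagreement and force over one period *)

Section MultistepDynamics.
Context {R : realType} {N n : nat} {e : rel 'I_N} {W : 'M[R]_N} {p q : 'cV[R]_N}.
Context {f : 'I_N -> int -> 'rV[R]_n -> 'rV[R]_n}.
Context {K : nat} {x : nat -> 'I_N -> 'rV[R]_n}.
Hypotheses (p_gt0 : forall i, 0 < p i 0) (q_gt0 : forall i, 0 < q i 0).
Hypotheses (qW : q^T *m W = q^T) (W_weights : weight_matrix e W).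
Hypotheses (K_gt0 : (0 < K)%N) (x_sol : multistep_solution e W f K x).

Definition weighted_mean t : 'rV[R]_n :=
  \sum_i q i 0 *: x (frac_time K t 0) i.

Definition disagreement t : R :=
  \sum_i eucl_norm (x (frac_time K t 0) i - p i 0 *: weighted_mean t).

Definition total_force t : R :=
  \sum_i eucl_norm (f i t%:Z (x (frac_time K t 0) i)).

Lemma disagreement_ge0 t : 0 <= disagreement t.
Proof. by apply: sumr_ge0 => i _; exact: eucl_norm_ge0. Qed.

Lemma total_force_ge0 t : 0 <= total_force t.
Proof. by apply: sumr_ge0 => i _; exact: eucl_norm_ge0. Qed.

Lemma le_disagreement t i :
  eucl_norm (x (frac_time K t 0) i - p i 0 *: weighted_mean t) <= disagreement t.
Proof.
rewrite /disagreement (bigD1 i) //= lerDl.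
by apply: sumr_ge0 => j _; exact: eucl_norm_ge0.
Qed.

Lemma frac_timeS t : frac_time K t K = frac_time K t.+1 0.
Proof. by rewrite /frac_time mulSn addn0 addnC. Qed.

(** The first of the [k.+1] substeps applies [f] and only the other [k] couple, hence the exponent
    [k]. *)
Lemma multistep_expand t k i : (k < K)%N ->
  x (frac_time K t k.+1) i =
  \sum_j (W ^+ k) i j *: f j t%:Z (x (frac_time K t 0) j).
Proof.
elim: k i => [|k IH] i kK; rewrite x_sol //=.
  rewrite (bigD1 i) //= expr0 mxE eqxx scale1r big1 ?addr0 // => j ji.
  by rewrite mxE eq_sym (negbTE ji) scale0r.
rewrite (weight_sum W_weights) expmxS.
transitivity (\sum_l \sum_j W i l *: ((W ^+ k) l j *:
    f j t%:Z (x (frac_time K t 0) j))).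
  by apply: eq_bigr => l _; rewrite IH ?(ltnW kK) // scaler_sumr.
rewrite exchange_big /=; apply: eq_bigr => j _.
by rewrite mxE scaler_suml; apply: eq_bigr => l _; rewrite scalerA.
Qed.

(** As [q^T W = q^T], coupling steps preserve the weighted mean; only the step with [f] changes
    it. *)
Lemma weighted_meanS t :
  weighted_mean t.+1 = \sum_j q j 0 *: f j t%:Z (x (frac_time K t 0) j).
Proof.
rewrite /weighted_mean -frac_timeS.
transitivity (\sum_i \sum_j q i 0 *: ((W ^+ K.-1) i j *:
    f j t%:Z (x (frac_time K t 0) j))).
  apply: eq_bigr => i _; rewrite -[X in frac_time K t X](prednK K_gt0).
  by rewrite multistep_expand ?prednK // scaler_sumr.
rewrite exchange_big /=; apply: eq_bigr => j _.
have /matrixP/(_ 0 j) := fix_expmx qW K.-1; rewrite !mxE => <-.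
by rewrite scaler_suml; apply: eq_bigr => i _; rewrite scalerA mxE.
Qed.

(** Node state and scaled mean combine the same forces, with coefficient matrices [W ^+ k] and
    [p *m q^T]. *)
Lemma multistep_deviation (C r : R) t k i : (k < K)%N ->
  (forall k i j, `|(W ^+ k - p *m q^T) i j| <= C * r ^+ k) ->
  eucl_norm (x (frac_time K t k.+1) i - p i 0 *: weighted_mean t.+1)
    <= C * r ^+ k * total_force t.
Proof.
move=> kK decay; rewrite multistep_expand // weighted_meanS scaler_sumr -sumrB.
apply: le_trans (eucl_norm_sum _) _; rewrite mulr_sumr; apply: ler_sum => j _.
rewrite scalerA -scalerBl eucl_normZ ler_wpM2r ?eucl_norm_ge0 //.
by have := decay k i j; rewrite !mxE big_ord1 !mxE.
Qed.

Lemma disagreementS (C r : R) t :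
  (forall k i j, `|(W ^+ k - p *m q^T) i j| <= C * r ^+ k) ->
  disagreement t.+1 <= N%:R * C * r ^+ K.-1 * total_force t.
Proof.
move=> decay; rewrite /disagreement.
apply: (@le_trans _ _ (\sum_(i < N) (C * r ^+ K.-1 * total_force t))).
  apply: ler_sum => i _.
  rewrite -frac_timeS -[X in frac_time K t X](prednK K_gt0).
  by apply: multistep_deviation => //; rewrite prednK.
by rewrite sumr_const card_ord -[leLHS]mulr_natl !mulrA.
Qed.

(** The blended map evaluates [f i] at the scaled mean instead of the true state; the Lipschitz
    bound charges the difference to the disagreement. *)
Lemma weighted_mean_blended (L : R) t : 0 <= L ->
  (forall i t x y, eucl_norm (f i t x - f i t y) <= L * eucl_norm (x - y)) ->
  eucl_norm (weighted_mean t.+1 - blended p q f t%:Z (weighted_mean t))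
    <= (\sum_i q i 0) * L * disagreement t.
Proof.
move=> L0 fL; rewrite weighted_meanS /blended -sumrB.
apply: le_trans (eucl_norm_sum _) _; rewrite -mulrA mulr_suml.
apply: ler_sum => i _; rewrite -scalerBr eucl_normZ gtr0_norm //.
apply: ler_wpM2l; first exact: ltW.
apply: le_trans (fL _ _ _ _) _; rewrite ler_wpM2l //; exact: le_disagreement.
Qed.

Lemma total_force_le (M0 L : R) t : 0 <= L ->
  (forall i t x, eucl_norm (f i t x) <= M0 + L * eucl_norm x) ->
  total_force t <= N%:R * M0 + L * (\sum_i p i 0) * eucl_norm (weighted_mean t)
    + L * disagreement t.
Proof.
move=> L0 fM; rewrite /total_force /disagreement.
have -> : N%:R * M0 = \sum_(i < N) M0 by rewrite sumr_const card_ord mulr_natl.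
rewrite -!mulrA mulr_suml !mulr_sumr -!big_split /=; apply: ler_sum => i _.
apply: le_trans (fM _ _ _) _; rewrite -addrA lerD2l -mulrDr ler_wpM2l //.
rewrite -{1}[x _ i](subrK (p i 0 *: weighted_mean t)) addrC.
apply: le_trans (eucl_normD _ _) _.
by rewrite eucl_normZ gtr0_norm // addrC.
Qed.

End MultistepDynamics.

(** * Choice of the constants and the two limit bounds *)

Theorem theorem1 (R : realType) (N n : nat)
  (e : rel 'I_N) (W : 'M[R]_N) (lam : N.-tuple R[i]) (p q : 'cV[R]_N)
  (f : 'I_N -> int -> 'rV[R]_n -> 'rV[R]_n)
  (e_irrefl : irreflexive e)
  (W_weights : weight_matrix e W)
  (lam_eigen : ordered_eigenvalues W lam)
  (p_gt0 : forall i, 0 < p i 0) (q_gt0 : forall i, 0 < q i 0)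
  (Wp : W *m p = p) (qW : q^T *m W = q^T) (qp : q^T *m p = 1%:M)
  (f_C1 : forall i t, continuously_differentiable (f i t))
  (W_radius : spectral_radius W = 1)
  (e_connected : strongly_connected e)
  (fs_contractive : contractive (blended p q f))
  (f_bounded_lipschitz : bounded_lipschitz f) :
  forall eps : R, 0 < eps ->
  exists Kmin : nat, forall K : nat, (Kmin < K)%N ->
  forall (x : nat -> 'I_N -> 'rV[R]_n) (s : nat -> 'rV[R]_n),
    multistep_solution e W f K x ->
    blended_solution (blended p q f) s ->
    (forall i : 'I_N,
      (limn_esup (fun t : nat =>
         (eucl_norm (x (frac_time K t 0) i - p i 0 *: s t))%:E)
       <= eps%:E)%E) /\
    (forall (k : nat) (i : 'I_N), (1 <= k <= K - 1)%N ->
      (limn_esup (fun t : nat =>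
         (eucl_norm (x (frac_time K t k) i - p i 0 *: s t.+1))%:E)
       <= intermediate_bound eps lam`_(N.-1) (K - k))%E).
Proof.
move=> eps eps0.
have [C [r [C0 /andP[r0 r1] decay lam_r]]] :=
  expmx_decay p_gt0 q_gt0 Wp qW qp W_weights e_connected lam_eigen.
have [H [gamma [Hpos /andP[gamma0 gamma1] Hgamma]]] := fs_contractive.
have [M [L [_ _ L0 fM fL]]] := f_bounded_lipschitz.
pose fs := blended p q f.
pose g := Num.sqrt gamma.
have g01 : 0 <= g < 1 by rewrite sqrtr_ge0 -sqrtr1 ltr_sqrt.
have /andP[g0 g1] := g01.
have fs_contr t a b :
    eucl_norm ((fs t a - fs t b) *m H) <= g * eucl_norm ((a - b) *m H).
  apply: contraction_of_jacobian; [exact: Hpos.1|exact: ltW| |exact: Hgamma].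
  by apply: blended_differentiable => i x; exact: (f_C1 i t).1.
(* [H] and its inverse translate between the Euclidean norm and the contracted norm [v H]. *)
have [cH cH0 hcH] := eucl_norm_mulmx H.
have [cI cI0 hcI'] := eucl_norm_mulmx (invmx H).
have hcI v : eucl_norm v <= cI * eucl_norm (v *m H).
  by have := hcI' (v *m H); rewrite mulmxK // posdef_unitmx.
(* The bound at the origin and the Lipschitz constant give the affine growth of the forces that the
   small-gain argument uses. *)
pose M0 := `|M 0|.
have fM0 i t : eucl_norm (f i t 0) <= M0.
  by apply: le_trans (fM i t 0) _; rewrite eucl_norm0 ler_norm.
have fM0L i t y : eucl_norm (f i t y) <= M0 + L * eucl_norm y.
  have := fL i t y 0; rewrite subr0 -{2}[f i t y](subrK (f i t 0)) => fy.
  by apply: le_trans (eucl_normD _ _) _; rewrite addrC lerD.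
pose sp := \sum_i p i 0; pose sq := \sum_i q i 0.
have sp0 : 0 <= sp by apply: sumr_ge0 => i _; exact: ltW.
have sq0 : 0 <= sq by apply: sumr_ge0 => i _; exact: ltW.
have p_sp i : p i 0 <= sp.
  by rewrite /sp (bigD1 i) //= lerDl sumr_ge0 // => j _; exact: ltW.
have fs0 t : eucl_norm (fs t 0 *m H) <= cH * (sq * M0).
  apply: le_trans (hcH _) _; rewrite ler_wpM2l // /fs /blended.
  apply: le_trans (eucl_norm_sum _) _; rewrite /sq mulr_suml.
  apply: ler_sum => i _; rewrite eucl_normZ gtr0_norm // scaler0.
  by apply: ler_wpM2l; first exact: ltW.
pose c1 := cH * (sq * L).
have c10 : 0 <= c1 by rewrite !mulr_ge0.
have M00 : 0 <= M0 by exact: normr_ge0.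
have [delta0 [B [delta00 B0 ultimate]]] :
    exists delta0 B : R, [/\ 0 < delta0, 0 <= B &
    forall (delta : R) (U E S : nat -> R), 0 <= delta <= delta0 ->
      (forall t, 0 <= U t) -> (forall t, 0 <= E t) ->
      (forall t, S t <= N%:R * M0 + (L * sp * cI) * U t + L * E t) ->
      (forall t, E t.+1 <= delta * S t) ->
      (forall t, U t.+1 <= g * U t + cH * (sq * M0) + c1 * E t) ->
      \forall t \near \oo, S t <= B].
  by apply: small_gain_ultimate_bound; rewrite ?mulr_ge0 // ler0n.
(* The accuracy required of [V], chosen so that the mean costs at most [eps / 2] at every node. *)
pose eta := eps / 2 / (sp * cI + 1).
have spcI : 0 <= sp * cI by rewrite mulr_ge0.
have eta0 : 0 < eta by rewrite /eta !divr_gt0 //; lra.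
have peta i : p i 0 * (cI * eta) <= eps / 2.
  apply: (@le_trans _ _ (sp * cI * eta)).
    by rewrite -mulrA; apply: ler_wpM2r => //; rewrite mulr_ge0 // ltW.
  rewrite /eta mulrCA ler_piMr //; first lra.
  by rewrite ler_pdivrMr; lra.
have c1B : 0 <= c1 * B by rewrite mulr_ge0.
(* The three bounds serve, in order, the small-gain lemma, [delta * B <= eps / 2] for the
   disagreement, and [c1 * (delta * B) < (1 - g) * eta] for the distance to [s]. *)
pose delta1 := Num.min delta0
  (Num.min (eps / 2 / (B + 1)) ((1 - g) * eta / (c1 * B + 1))).
have delta10 : 0 < delta1.
  rewrite !lt_min delta00 /=; apply/andP; split; apply: divr_gt0; try lra.
  by apply: mulr_gt0; lra.
have rk : (fun k => N%:R * C * r ^+ k) @ \oo --> 0.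
  rewrite -(mulr0 (N%:R * C)); apply: cvgMr; apply: cvg_expr.
  by rewrite ger0_norm // ltW.
have [k0 _ hk0] := cvgr_le 0 rk delta1 delta10.
(* [k0 < K] means [k0 <= K.-1], the number of coupling steps in a period. *)
exists k0 => K K_k0 x s x_sol s_sol.
have K0 : (0 < K)%N by exact: leq_ltn_trans (leq0n k0) K_k0.
pose delta := N%:R * C * r ^+ K.-1.
have delta_ge0 : 0 <= delta by rewrite !mulr_ge0 // exprn_ge0 // ltW.
have /and3P[delta_le0 delta_leB delta_leeta] :
    [&& delta <= delta0, delta <= eps / 2 / (B + 1) &
        delta <= (1 - g) * eta / (c1 * B + 1)].
  have : delta <= delta1 by apply: hk0 => /=; rewrite -ltnS prednK.
  by rewrite !le_min.
pose xi := @weighted_mean R N n q K x.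
pose E := @disagreement R N n p q K x.
pose S := @total_force R N n f K x.
have E_S t : E t.+1 <= delta * S t by exact: (disagreementS qW W_weights K0 x_sol C r t decay).
have xi_fs t : eucl_norm ((xi t.+1 - fs t%:Z (xi t)) *m H) <= c1 * E t.
  apply: le_trans (hcH _) _; rewrite /c1 -mulrA ler_wpM2l //.
  exact: (weighted_mean_blended q_gt0 qW W_weights K0 x_sol L t L0 fL).
pose U t := eucl_norm (xi t *m H).
pose V t := eucl_norm ((xi t - s t) *m H).
have S_le t : S t <= N%:R * M0 + (L * sp * cI) * U t + L * E t.
  apply: le_trans (total_force_le p_gt0 (q := q) M0 L t L0 fM0L) _.
  by rewrite lerD2r lerD2l -[leRHS]mulrA ler_wpM2l ?mulr_ge0.
have U_le t : U t.+1 <= g * U t + cH * (sq * M0) + c1 * E t.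
  rewrite /U.
  (* The blended step from 0 is the reference: contraction bounds the increment, and [fs t 0] is
     bounded uniformly in time. *)
  have -> : xi t.+1 *m H = (xi t.+1 - fs t%:Z (xi t)) *m H +
      ((fs t%:Z (xi t) - fs t%:Z 0) *m H + fs t%:Z 0 *m H).
    by rewrite -!mulmxDl !subrK.
  have := fs_contr t%:Z (xi t) 0; rewrite subr0 => fs_xi.
  apply: le_trans (eucl_normD _ _) _; rewrite addrC lerD //.
  by apply: le_trans (eucl_normD _ _) _; rewrite lerD.
have S_B : \forall t \near \oo, S t <= B.
  apply: (ultimate delta U E S) => //; first by rewrite delta_ge0.
  - by move=> t; exact: eucl_norm_ge0.
  - by move=> t; exact: disagreement_ge0.
have E_B : \forall t \near \oo, E t <= delta * B.
  apply: eventually_unshift; near=> t.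
  apply: le_trans (E_S t) _; rewrite ler_wpM2l //.
  by near: t.
have V_eta : \forall t \near \oo, V t <= eta.
  apply: (affine_recurrence_le V g (c1 * (delta * B))) => //.
    rewrite mulrCA.
    have : delta * (c1 * B + 1) <= (1 - g) * eta.
      by rewrite -ler_pdivlMr //; lra.
    (* Strictness comes from the 1 in [c1 * B + 1] if [delta] is positive, and from [0 < eta]
       otherwise. *)
    have [d_eq0 _|d0] := eqVneq delta 0.
      by rewrite d_eq0 mul0r mulr_gt0 // subr_gt0.
    apply: lt_le_trans; rewrite mulrDr mulr1 ltrDl.
    by rewrite lt_def d0.
  near=> t; rewrite /V s_sol.
  have -> : (xi t.+1 - fs t%:Z (s t)) *m H = (fs t%:Z (xi t) - fs t%:Z (s t)) *m H
      + (xi t.+1 - fs t%:Z (xi t)) *m H.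
    by rewrite -mulmxDl [in RHS]addrC addrA subrK.
  apply: le_trans (eucl_normD _ _) _; rewrite lerD //.
  apply: le_trans (xi_fs t) _; rewrite ler_wpM2l //.
  by near: t.
have mean_bound t i : V t <= eta ->
    eucl_norm (p i 0 *: xi t - p i 0 *: s t) <= eps / 2.
  move=> Vt; rewrite -scalerBr eucl_normZ gtr0_norm //.
  apply: le_trans (peta i); apply: ler_wpM2l; first exact: ltW.
  by apply: le_trans (hcI _) _; rewrite ler_wpM2l.
have delta_B : delta * B <= eps / 2.
  apply: (@le_trans _ _ (delta * (B + 1))); first by rewrite ler_wpM2l //; lra.
  by rewrite -ler_pdivlMr //; lra.
have split_norm (a b c : 'rV[R]_n) :
    eucl_norm (a - c) <= eucl_norm (a - b) + eucl_norm (b - c).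
  by rewrite -{1}[a](subrK b) -addrA; exact: eucl_normD.
split=> [i|k i /andP[k1 kK]].
  apply: limn_esup_le_near; near=> t.
  apply: le_trans (split_norm _ (p i 0 *: xi t) _) _.
  rewrite [leRHS]splitr; apply: lerD.
    apply: le_trans delta_B; apply: (@le_trans _ _ (E t)).
      exact: le_disagreement.
    by near: t.
  by apply: mean_bound; near: t.
rewrite /intermediate_bound; have [_|lam0] := eqVneq lam`_N.-1 0.
  by rewrite leey.
(* From here on [k] counts the coupling steps already made, which is the exponent of [W]. *)
case: k k1 kK => // k _ kK.
have kK' : (k < K)%N by exact: leq_trans kK (leq_subr _ _).
have VS_eta := eventually_shift V_eta.
apply: limn_esup_le_near; near=> t.
apply: le_trans (split_norm _ (p i 0 *: xi t.+1) _) _.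
rewrite mulrDr mulr1 [leRHS]addrC; apply: lerD; last first.
  by apply: mean_bound; near: t.
apply: le_trans (multistep_deviation qW W_weights K0 x_sol C r t k i kK' decay) _.
have lamgt0 := cmod_gt0 _ lam0.
rewrite mul1r ler_pdivlMr ?exprn_gt0 //.
apply: le_trans delta_B.
have St : S t <= B by near: t.
(* Since [r] dominates the last modulus, its [K - k.+1] factors complete [r ^+ k] to at most
   [r ^+ K.-1]; the factor [N] is at least 1 because the node [i] exists. *)
have Crk : C * r ^+ k * cmod lam`_N.-1 ^+ (K - k.+1) <= delta.
  have -> : delta = N%:R * (C * (r ^+ k * r ^+ (K - k.+1))).
    by rewrite /delta -exprD mulrA subnS -!subn1 addnBA ?subn_gt0 // subnKC // ltnW.
  have N1 : (1 : R) <= N%:R by rewrite ler1n; exact: leq_trans (ltn_ord i).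
  case: lam_r => [->|lam_r]; first by rewrite !mul0r mulr0.
  rewrite -mulrA; apply: (@le_trans _ _ (C * (r ^+ k * r ^+ (K - k.+1)))).
    rewrite ler_wpM2l // ler_wpM2l ?exprn_ge0 ?(ltW r0) //.
    by rewrite lerXn2r ?nnegrE // ltW.
  by rewrite ler_peMl // !mulr_ge0 // exprn_ge0 // ltW.
rewrite mulrAC; apply: ler_pM => //; last exact: total_force_ge0.
by rewrite !mulr_ge0 // exprn_ge0 // ltW.
Unshelve. all: by end_near.
Qed.
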